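(* Let $r<m$ be positive integers and let $M\in\mathcal{M}_{r,m}(\mathbb{Z})$ be admissible. Then $t(n)=n^{-1/c(M)}$ is a threshold function for the property ''$\mathcal{A}$ contains a non-trivial solution of $M\cdot\mathbf{x}=\mathbf{0}$'', where $\mathcal{A}$ is drawn from $[n]_p$. That is: if $p=o(n^{-1/c(M)})$ then $\mathbb{P}(\mathcal{A}^m \text{ contains a non-trivial solution of } M\cdot\mathbf{x}=\mathbf{0})\to 0$ as $n\to\infty$, and if $p=\omega(n^{-1/c(M)})$ then this probability tends to $1$.
   Context: Random model: $[n]=\{1,\dots,n\}$; for $p=p(n)\in[0,1]$, $[n]_p$ denotes the random subset $\mathcal{A}\subseteq[n]$ in which each element is included independently with probability $p$. $\mathcal{A}$ contains a solution of $M\cdot\mathbf{x}=\mathbf{0}$ if there is $\mathbf{x}=(x_1,\dots,x_m)^T\in\mathcal{A}^m$ with $M\mathbf{x}=\mathbf{0}$. A matrix $M\in\mathcal{M}_{r,m}(\mathbb{Z})$ (with $r<m$) is admissible if (1) (positivity) $M\mathbf{x}=\mathbf{0}$ has a solution with all entries positive; (2) (irredundancy) for every $i\neq j$ there is a solution $\mathbf{x}$ with $x_i\neq x_j$; (3) (non-degeneracy) $M$ has rank $r$. Trivial solutions: for a solution $\mathbf{x}$, let $\mathfrak{p}(\mathbf{x})$ be the set partition of $\{1,\dots,m\}$ whose blocks are the classes of indices $i$ with equal $x_i$. For a set partition $\mathfrak{p}$ of $\{1,\dots,m\}$, $M_{\mathfrak{p}}\in\mathcal{M}_{r,|\mathfrak{p}|}(\mathbb{Z})$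 is the matrix obtained from $M$ by replacing, for each block, the columns indexed by that block by their sum. A solution $\mathbf{x}$ is trivial if $\mathrm{rk}(M_{\mathfrak{p}(\mathbf{x})})<r$, and non-trivial otherwise. The parameter $c(M)$: for $Q\subseteq\{1,\dots,m\}$ let $\bar Q=\{1,\dots,m\}\setminus Q$, let $M^{\bar Q}$ be the submatrix of $M$ consisting of the columns indexed by $\bar Q$ (with the empty matrix having rank $0$), and let $r_Q=r-\mathrm{rk}(M^{\bar Q})$. Then $c(M)=\max_{\emptyset\neq Q\subseteq\{1,\dots,m\}} \frac{|Q|}{|Q|-r_Q}$. *)

(* Defs.v *)
From HB Require Import structures.
From mathcomp Require Import all_boot all_order all_algebra.
From Stdlib Require Import Reals.
Local Open Scope ring_scope.

Set Implicit Arguments.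
Unset Strict Implicit.
Unset Printing Implicit Defensive.

Import GRing.Theory Num.Theory.

Definition zrank (r m : nat) (M : 'M[int]_(r, m)) : nat :=
  \rank (map_mx (fun z : int => (z%:~R : rat)) M).

Definition is_solution (r m : nat) (M : 'M[int]_(r, m)) (x : 'I_m -> int) : bool :=
  [forall i : 'I_r, \sum_(j < m) M i j * x j == 0].

Definition part_of (m : nat) (x : 'I_m -> int) : {set {set 'I_m}} :=
  [set [set j | x j == x i] | i : 'I_m].

Definition Mpart (r m : nat) (M : 'M[int]_(r, m)) (P : {set {set 'I_m}})
  : 'M[int]_(r, #|P|) :=
  \matrix_(i < r, k < #|P|) \sum_(j in (enum_val k : {set 'I_m})) M i j.

Definition nontrivial (r m : nat) (M : 'M[int]_(r, m)) (x : 'I_m -> int) : bool :=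
  zrank (Mpart M (part_of x)) == r.

Definition admissible (r m : nat) (M : 'M[int]_(r, m)) : Prop :=
  [/\ (exists x : 'I_m -> int, (forall j, 0 < x j) /\ is_solution M x),
      (forall i j : 'I_m, i <> j ->
          exists x : 'I_m -> int, is_solution M x /\ x i <> x j)
    & zrank M = r].

Local Close Scope ring_scope.
Local Open Scope R_scope.

Definition colsubset (r m : nat) (M : 'M[int]_(r, m)) (S : {set 'I_m})
  : 'M[int]_(r, #|S|) :=
  \matrix_(i < r, k < #|S|) M i (enum_val k).

Definition rQ (r m : nat) (M : 'M[int]_(r, m)) (Q : {set 'I_m}) : R :=
  (INR r - INR (zrank (colsubset M (~: Q))))%R.

Definition cM (r m : nat) (M : 'M[int]_(r, m)) : R :=
  \big[Rmax/0%R]_(Q : {set 'I_m} | Q != set0)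
     (INR #|Q| / (INR #|Q| - rQ M Q))%R.

(* A subset of [n] (element a : 'I_n stands for the integer a+1) contains a
   non-trivial solution of M x = 0 *)
Definition has_nontriv_sol (r m n : nat) (M : 'M[int]_(r, m)) (A : {set 'I_n})
  : bool :=
  [exists f : {ffun 'I_m -> 'I_n},
     [forall j, f j \in A] &&
     is_solution M (fun j => Posz (f j).+1) &&
     nontrivial M (fun j => Posz (f j).+1)].

Definition prob_nontriv (r m : nat) (M : 'M[int]_(r, m)) (p : nat -> R) (n : nat)
  : R :=
  \big[Rplus/0%R]_(A : {set 'I_n})
     (if has_nontriv_sol M A
      then (p n ^ #|A| * (1 - p n) ^ (subn n #|A|))%R else 0%R).

Definition threshold_t (r m : nat) (M : 'M[int]_(r, m)) (n : nat) : R :=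
  Rpower (INR n) (- / cM M)%R.

(* Main.v *)
(** Write [r_Q = r - rk M^{~Q}]. Combining the equations by the left kernel of the
    columns outside [Q] gives [r_Q] independent equations in the unknowns of [Q]; they stay
    independent after the unknowns are identified along a partition [P] with [rk M_P = r].
    So the restrictions to [Q] of the non-trivial solutions in [[n]] with a given equality
    pattern, having [k <= |Q|] distinct values on [Q], form at most [n^(k - r_Q)] sets of
    size [k]. For [Q] attaining [c(M)] we have [k - r_Q <= k / c(M)], and the union bound
    gives a probability [O(q)], where [q = p n^(1/c(M))], as soon as [q <= 1].

    Conversely a positive solution with distinct entries (positivity and irredundancy),
    dilated and perturbed by differences of points in a fibre of [M], gives at least a
    constant times [n^(m-r)] solutions with distinct entries. Two such solutions which meet
    exactly in the entries [Q] of the second one form at most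
    [O(n^(2(m-r) - (|Q| - r_Q)))] pairs, and [n^(|Q| - r_Q) p^|Q| >= q^|Q|], so
    Chebyshev's inequality bounds the probability of containing no such solution by [O(1/q)]. *)

Require Import Defs.
From HB Require Import structures.
From Stdlib Require Import Reals.
From mathcomp Require Import all_boot all_order all_algebra.
From mathcomp Require Import Rstruct ring zify.

Set Implicit Arguments.
Unset Strict Implicit.
Unset Printing Implicit Defensive.

Import Order.TTheory GRing.Theory Num.Theory.
Local Open Scope ring_scope.

(** * Rank and non-trivial solutions *)

Section ColumnBasis.
Variable F : fieldType.

(** [T] indexes a maximal independent family of columns, so a kernel vector supported on [T] would
    be a linear relation among them. *)
Lemma column_basis (a b : nat) (N : 'M[F]_(a, b)) :
  exists T : {set 'I_b}, #|T| = \rank N /\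
    forall y : 'cV_b, N *m y = 0 -> (forall i, i \notin T -> y i 0 = 0) -> y = 0.
Proof.
pose f := maxrankfun N^T.
have f_inj : injective f by exact: maxrankfun_inj.
exists (f @: setT); split.
  by rewrite card_imset // cardsT card_ord mxrank_tr.
move=> y Ny0 y0.
pose z := \row_k y (f k) 0.
have z0 : z = 0.
  apply: (row_free_inj (maxrowsub_free N^T)).
  rewrite mul0mx; apply/rowP=> i; rewrite !mxE.
  transitivity ((N *m y) i 0); last by rewrite Ny0 mxE.
  rewrite mxE [RHS](bigID (mem (f @: setT))) /= [X in _ = _ + X]big1 ?addr0.
    rewrite big_imset /=; last by move=> ? ? _ _; apply: f_inj.
    by apply: eq_big => [k|k _]; rewrite ?in_setT // !mxE mulrC.
  by move=> j /y0 ->; rewrite mulr0.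
apply/colP=> i; rewrite mxE; case: (boolP (i \in f @: setT)) => [/imsetP[k _ ->]|/y0 //].
by have := congr1 (fun v : 'rV__ => v 0 k) z0; rewrite !mxE.
Qed.

Lemma column_basis_nonzero (a b : nat) (N : 'M[F]_(a, b)) :
  exists T : {set 'I_b}, [/\ #|T| = \rank N,
    forall i, i \in T -> col i N != 0 &
    forall y : 'cV_b, N *m y = 0 -> (forall i, i \notin T -> y i 0 = 0) -> y = 0].
Proof.
have [T [cT HT]] := column_basis N; exists T; split=> // i iT.
apply/eqP=> coli0.
(* If column [i] were zero, the unit vector at [i] would be a nonzero kernel vector supported on
   [T]. *)
have : delta_mx i 0 = 0 :> 'cV[F]_b.
  apply: HT; first by rewrite -colE.
  by move=> j jT; rewrite mxE; case: eqP => // ji; move: jT; rewrite ji iT.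
by move/matrixP/(_ i 0); rewrite !mxE !eqxx => /eqP; rewrite oner_eq0.
Qed.

(** [S] is the set of free variables in [B], namely [B] without a column basis: once they vanish,
    the rest of [y] on [B] is a relation among basis columns. *)
Lemma determining_set (a b : nat) (N : 'M[F]_(a, b)) (B : {set 'I_b}) :
  (forall i, i \notin B -> col i N = 0) ->
  exists S : {set 'I_b}, [/\ S \subset B, (#|S| + \rank N)%N = #|B| &
    forall y : 'cV_b, N *m y = 0 -> (forall i, i \in S -> y i 0 = 0) ->
      forall i, i \in B -> y i 0 = 0].
Proof.
move=> N0; have [T [cT Tn0 HT]] := column_basis_nonzero N.
have TB : T \subset B.
  by apply/subsetP=> i iT; apply/negPn/negP=> /N0 e; move: (Tn0 i iT); rewrite e eqxx.
exists (B :\: T); split; first exact: subsetDl.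
  by rewrite -cT cardsD (setIidPr TB) subnK ?subset_leq_card.
move=> y Ny0 y0.
pose z : 'cV[F]_b := \col_i (if i \in B then y i 0 else 0).
suff z0 : z = 0 by move=> i iB; have /colP/(_ i) := z0; rewrite !mxE iB.
apply: HT.
  rewrite -Ny0; apply/colP=> k; rewrite !mxE; apply: eq_bigr=> i _; rewrite !mxE.
  case: ifP => // /negbT /N0 /colP/(_ k); rewrite !mxE => ->; by rewrite !mul0r.
move=> i iT; rewrite mxE; case: ifP => // iB; apply: y0; by rewrite inE iT iB.
Qed.

End ColumnBasis.

Definition zero_cols (F : fieldType) (r m : nat) (A : 'M[F]_(r, m)) (Q : {set 'I_m}) : 'M_(r, m) :=
  \matrix_(i, j) (if j \in Q then 0 else A i j).

Section System.
Variables (r m : nat) (M : 'M[int]_(r, m)).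
Implicit Types (x : 'I_m -> int) (Q : {set 'I_m}).

Notation Mq := (map_mx (fun z : int => (z%:~R : rat)) M).
(* The rank of [M^{~Q}]: the columns in [Q] are zeroed rather than deleted, so that
   all systems keep the index set ['I_m]. *)
Definition crank Q := \rank (zero_cols Mq Q).

Lemma zrank_colsubset Q : zrank (colsubset M (~: Q)) = crank Q.
Proof.
rewrite /zrank /crank; set C := map_mx _ _.
pose D : 'M[rat]_(m, #|~: Q|) := \matrix_(j, k) (j == enum_val k)%:R.
apply/eqP; rewrite eqn_leq; apply/andP; split.
  suff -> : C = zero_cols Mq Q *m D by exact: mxrankM_maxl.
  apply/matrixP=> i k; rewrite !mxE (bigD1 (enum_val k)) //= big1 ?addr0.
    rewrite !mxE eqxx mulr1; case: ifP => //.
    by have := enum_valP k; rewrite inE => /negbTE ->.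
  by move=> j /negbTE jk; rewrite !mxE jk mulr0.
suff -> : zero_cols Mq Q = C *m D^T by exact: mxrankM_maxl.
apply/matrixP=> i j; rewrite !mxE; case: ifPn => jQ.
  rewrite big1 // => k _; rewrite !mxE; case: eqP => [e|]; last by rewrite mulr0.
  by have := enum_valP k; rewrite -e inE jQ.
have jQ' : j \in ~: Q by rewrite inE.
rewrite (bigD1 (enum_rank_in jQ' j)) //= big1 ?addr0.
  by rewrite !mxE enum_rankK_in // eqxx mulr1.
move=> k /eqP nk; rewrite !mxE; case: eqP => [e|]; last by rewrite mulr0.
by case: nk; apply: enum_val_inj; rewrite enum_rankK_in.
Qed.

Lemma crank_le Q : (crank Q <= r)%N. Proof. exact: rank_leq_row. Qed.

Definition ratcol x : 'cV[rat]_m := \col_j (x j)%:~R.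

Lemma is_solutionP x : reflect (Mq *m ratcol x = 0) (is_solution M x).
Proof.
have E i : (Mq *m ratcol x) i 0 = (\sum_(j < m) M i j * x j)%:~R.
  by rewrite mxE rmorph_sum; apply: eq_bigr => j _; rewrite !mxE rmorphM.
apply: (iffP forallP) => [H|H i].
  by apply/colP=> i; rewrite E (eqP (H i)) mxE.
by apply/eqP/(@intr_inj rat); rewrite -E H mxE.
Qed.

(** Full row rank of $M_{\mathfrak{p}(x)}$ says that no nonzero combination [u] of the equations
    dies when the columns of each class of equal entries are added. This form dispenses with the
    enumeration of blocks in [Mpart]. *)
Lemma nontrivialP x :
  (forall u : 'rV[rat]_r, (forall i, \sum_(j | x j == x i) (u *m Mq) 0 j = 0) -> u = 0)
  <-> nontrivial M x.
Proof.
rewrite /nontrivial /zrank; set P := map_mx _ (Mpart M _).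
have PE (u : 'rV_r) k : (u *m P) 0 k = \sum_(j in (enum_val k : {set 'I_m})) (u *m Mq) 0 j.
  rewrite !mxE; under [RHS]eq_bigr do rewrite mxE.
  rewrite exchange_big /=; apply: eq_bigr => i _.
  rewrite !mxE rmorph_sum mulr_sumr; apply: eq_bigr => j _; by rewrite mxE.
have eqv (u : 'rV_r) : (forall i, \sum_(j | x j == x i) (u *m Mq) 0 j = 0) <-> u *m P = 0.
  split=> [H|H i].
    apply/rowP=> k; rewrite PE mxE.
    have /imsetP[i _ ->] := enum_valP k.
    by apply: etrans (H i); apply: eq_bigl => j; rewrite inE.
  have iP : [set j | x j == x i] \in part_of x by apply: imset_f.
  have := PE u (enum_rank_in iP [set j | x j == x i]).
  rewrite H mxE enum_rankK_in // => e0; rewrite [RHS]e0; by apply: eq_bigl => j; rewrite inE.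
split=> [H|H u /eqv uP].
  by apply: inj_row_free => u /eqv /H.
by apply: (row_free_inj H); rewrite uP mul0mx.
Qed.

Lemma nontrivial_injective x : zrank M = r -> injective x -> nontrivial M x.
Proof.
move=> rM inj; apply/nontrivialP=> u H.
have /row_free_inj : row_free Mq by apply/eqP.
apply; rewrite mul0mx; apply/rowP=> i; rewrite [RHS]mxE; apply: etrans (H i).
by rewrite (big_pred1 i) // => j; rewrite /= (inj_eq inj).
Qed.

Section Pattern.
Variables (n : nat).
Implicit Types f : {ffun 'I_m -> 'I_n}.

Definition ival f : 'I_m -> int := fun j => Posz (f j).+1.

Lemma ival_eq f i j : (ival f i == ival f j) = (f i == f j).
Proof. by rewrite /ival eqz_nat eqSS. Qed.

Definition diffcol f g : 'cV[rat]_m := ratcol (ival f) - ratcol (ival g).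

Lemma diffcol_eq0 f g i : (diffcol f g i 0 == 0) = (f i == g i).
Proof.
by rewrite !mxE subr_eq0 (inj_eq (@intr_inj _)) eqz_nat eqSS.
Qed.

(** On [F] the map [h] factors through restriction to [S]. It is needed for the identity, to count
    solutions, and for the image of [Q], to count sets. *)
Lemma card_restr_inj (F : {set {ffun 'I_m -> 'I_n}}) (S : {set 'I_m})
    (T : finType) (h : {ffun 'I_m -> 'I_n} -> T) :
  {in F &, forall f g : {ffun 'I_m -> 'I_n}, (forall i, i \in S -> f i = g i) -> h f = h g} ->
  (#|h @: F| <= n ^ #|S|)%N.
Proof.
move=> H; pose e f : {ffun 'I_#|S| -> 'I_n} := [ffun k => f (enum_val k)].
have -> : (n ^ #|S|)%N = #|{ffun 'I_#|S| -> 'I_n}| by rewrite card_ffun !card_ord.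
apply: leq_trans (max_card (mem (e @: F))).
have [->|[f0 f0F]] := set_0Vmem F; first by rewrite imset0 cards0.
(* [k] picks a member of [F] with the given restriction; the default [f0] is never reached on
   [e @: F]. *)
pose k v := h (odflt f0 [pick f in F | e f == v]).
suff -> : h @: F = k @: (e @: F) by exact: leq_imset_card.
rewrite -imset_comp; apply: eq_in_imset => f fF /=; rewrite /k.
case: pickP => [g /andP[gF /eqP egf]|/(_ f)]; last by rewrite fF eqxx.
apply: H => // i iS; have := congr1 (fun v : {ffun _} => v (enum_rank_in iS i)) egf.
by rewrite !ffunE enum_rankK_in.
Qed.

(** The difference of two members of [F] vanishes on [Q], hence lies in the kernel of the columns
    outside [Q], where [m - #|Q| - crank M Q] free entries determine it. *)
Lemma card_solutions_fixed (F : {set {ffun 'I_m -> 'I_n}}) Q :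
  {in F, forall f : {ffun 'I_m -> 'I_n}, is_solution M (ival f)} ->
  {in F &, forall f g : {ffun 'I_m -> 'I_n}, forall i, i \in Q -> f i = g i} ->
  (crank Q + #|Q| <= m)%N /\ (#|F| <= n ^ (m - #|Q| - crank Q))%N.
Proof.
move=> solF agree.
have [S [SB cS HS]] := @determining_set _ _ _ (zero_cols Mq Q) (~: Q)
  ltac:(by move=> i; rewrite inE negbK => iQ; apply/colP=> k; rewrite !mxE iQ).
have cQ := cardsC Q; rewrite card_ord in cQ.
rewrite -/(crank Q) in cS; split; first by lia.
have -> : (m - #|Q| - crank Q)%N = #|S| by lia.
have -> : #|F| = #|id @: F| by rewrite card_imset.
apply: card_restr_inj => f g fF gF fg; apply/ffunP=> i.
apply/eqP; rewrite -diffcol_eq0; apply/eqP.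
have dQ j : j \in Q -> diffcol f g j 0 = 0.
  by move=> jQ; apply/eqP; rewrite diffcol_eq0 (agree f g).
case: (boolP (i \in Q)) => [/dQ //|iQ]; apply: HS; rewrite ?inE //.
  have /is_solutionP sf := solF f fF; have /is_solutionP sg := solF g gF.
  have : Mq *m diffcol f g = 0 by rewrite mulmxBr sf sg subrr.
  move=> D0; apply: etrans D0; apply/colP=> k; rewrite !mxE; apply: eq_bigr => j _.
  rewrite mxE; case: ifP => // /dQ ->; by rewrite !mulr0.
by move=> j jS; apply/eqP; rewrite diffcol_eq0 fg.
Qed.

End Pattern.
End System.

(** * Equality patterns *)

Section Collapse.
Variables (r m : nat) (M : 'M[int]_(r, m)) (Q : {set 'I_m}).
Notation Mq := (map_mx (fun z : int => (z%:~R : rat)) M).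

(** When [pi] sends each index to a representative of its block, [Mq *m collapse_mx pi] is
    $M_{\mathfrak{p}}$ with each block sum stored at the representative and zero columns
    elsewhere. *)
Definition collapse_mx (pi : 'I_m -> 'I_m) : 'M[rat]_m := \matrix_(j, i) (pi j == i)%:R.

Lemma mul_collapse_mx (pi : 'I_m -> 'I_m) (a : nat) (A : 'M[rat]_(a, m)) k i :
  (A *m collapse_mx pi) k i = \sum_(j | pi j == i) A k j.
Proof.
rewrite mxE [RHS]big_mkcond /=; apply: eq_bigr => j _.
by rewrite mxE; case: eqP; rewrite ?mulr1 ?mulr0.
Qed.

(** The left kernel [U] of the columns outside [Q] has rank [r - crank M Q], and multiplying it by a
    row-free matrix preserves this rank. An index outside [pi @: Q] collects only columns outside
    [Q], which [U] kills, so the resulting system involves [pi @: Q] alone. *)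
Lemma collapse_determining_set (pi : 'I_m -> 'I_m) :
  row_free (Mq *m collapse_mx pi) ->
  exists S : {set 'I_m}, [/\ S \subset pi @: Q, (#|S| + (r - crank M Q))%N = #|pi @: Q| &
    forall y : 'cV_m, Mq *m y = 0 -> (forall j, y (pi j) 0 = y j 0) ->
      (forall i, i \in S -> y i 0 = 0) -> forall i, i \in pi @: Q -> y i 0 = 0].
Proof.
set G := collapse_mx pi => Wfree.
pose U := kermx (zero_cols Mq Q).
have [|S [SB cS HS]] := @determining_set _ _ _ (U *m (Mq *m G)) (pi @: Q).
  move=> i iQ; apply/colP=> k; rewrite mulmxA mxE mul_collapse_mx [RHS]mxE.
  rewrite big1 // => j /eqP pij.
  have jQ : j \notin Q by apply: contra iQ => jQ; rewrite -pij imset_f.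
  transitivity ((U *m zero_cols Mq Q) k j); last by rewrite mulmx_ker mxE.
  by rewrite !mxE; apply: eq_bigr => l _; rewrite !mxE (negbTE jQ).
exists S; split=> //.
  by rewrite -cS mxrankMfree // mxrank_ker.
move=> y My0 ypi; apply: HS.
suff Gy : G *m y = y by rewrite -mulmxA -(mulmxA Mq) Gy My0 mulmx0.
apply/colP=> j; rewrite mxE.
rewrite (bigD1 (pi j)) //= big1 ?addr0; first by rewrite mxE eqxx mul1r ypi.
by move=> i /negbTE; rewrite mxE eq_sym => ->; rewrite mul0r.
Qed.

(** Take the identity pattern: if $r_Q = |Q|$, then [S] is empty and every solution vanishes on [Q],
    unlike the positive one. This makes the denominators in $c(M)$ positive. *)
Lemma rank_deficit_lt (x : 'I_m -> int) :
  zrank M = r -> is_solution M x -> (forall j, 0 < x j) -> Q != set0 ->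
  (r < crank M Q + #|Q|)%N.
Proof.
move=> rM sx x0 /set0Pn[q qQ].
have [|S [SB cS HS]] := @collapse_determining_set id.
  have -> : collapse_mx id = 1%:M by apply/matrixP=> i j; rewrite !mxE.
  by rewrite mulmx1; apply/eqP.
rewrite imset_id in SB cS HS.
have : S != set0.
  apply/eqP=> S0; have := HS (ratcol x); move/(_ _ _ _ q qQ).
  rewrite mxE => H; have := x0 q; suff -> : x q = 0 by [].
  apply/eqP; rewrite -(intr_eq0 rat); apply/eqP; apply: H => //.
    exact/is_solutionP.
  by move=> i; rewrite S0 inE.
rewrite -card_gt0 => S0; have cr := crank_le M Q.
have cS' : (#|S| + (r - crank M Q))%N = #|Q| by [].
by lia.
Qed.

Variable n : nat.
Implicit Types f g : {ffun 'I_m -> 'I_n}.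

(* Sends each index to a representative of its class under [f], chosen in [Q] whenever
   the class meets [Q]. *)
Definition pattern f : {ffun 'I_m -> 'I_m} :=
  [ffun i => odflt (odflt i [pick j | f j == f i]) [pick j in Q | f j == f i]].

Lemma pattern_eq f i : f (pattern f i) = f i.
Proof.
rewrite ffunE; case: pickP => [j /eqP fj|/(_ i)]; last by rewrite eqxx.
by case: pickP => [k /andP[_ /eqP]|].
Qed.

Lemma eq_pattern f i j : (pattern f i == pattern f j) = (f i == f j).
Proof.
apply/eqP/eqP => [e|e]; first by rewrite -pattern_eq e pattern_eq.
rewrite !ffunE e; case: pickP => [k _ //|/(_ j)]; by rewrite eqxx.
Qed.

Lemma card_pattern f : #|pattern f @: Q| = #|f @: Q|.
Proof.
rewrite -(card_in_imset (f := f) (D := pattern f @: Q)).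
  congr #|pred_of_set _|; rewrite -imset_comp; apply: eq_imset => i /=.
  exact: pattern_eq.
by move=> _ _ /imsetP[i _ ->] /imsetP[j _ ->]; rewrite !pattern_eq => e; apply/eqP; rewrite eq_pattern e.
Qed.

(** The set [f @: Q] can be read off from the values of [f] at the representatives [pi @: Q], and
    those are determined by the values on [S]. Non-triviality of one member of [F] supplies the row
    freeness. *)
Lemma card_images (F : {set {ffun 'I_m -> 'I_n}}) (pi : {ffun 'I_m -> 'I_m}) :
  F != set0 ->
  {in F, forall f : {ffun 'I_m -> 'I_n},
     [/\ is_solution M (ival f), nontrivial M (ival f) & pattern f = pi]} ->
  (r <= #|pi @: Q| + crank M Q)%N /\
  (#|[set f @: Q | f : {ffun 'I_m -> 'I_n} in F]| <= n ^ (#|pi @: Q| - (r - crank M Q)))%N.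
Proof.
move=> /set0Pn[f0 f0F] HF.
have [|S [SB cS HS]] := @collapse_determining_set pi.
  apply: inj_row_free => u uW; have [_ /nontrivialP nt pf0] := HF f0 f0F.
  apply: nt => i; have /rowP/(_ (pi i)) := uW.
  rewrite mulmxA mul_collapse_mx [RHS]mxE => s0; apply: etrans s0; apply: eq_bigl => j.
  by rewrite ival_eq -pf0 eq_pattern.
have cr := crank_le M Q.
split; first lia.
have -> : (#|pi @: Q| - (r - crank M Q))%N = #|S| by lia.
apply: card_restr_inj => f g fF gF fg.
have [/is_solutionP sf _ pf] := HF f fF; have [/is_solutionP sg _ pg] := HF g gF.
apply: eq_in_imset => i iQ; rewrite -(pattern_eq f) -(pattern_eq g) pf pg.
apply/eqP; rewrite -diffcol_eq0; apply/eqP; apply: HS.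
- by rewrite mulmxBr sf sg subrr.
- move=> j; rewrite !mxE /ival.
  by rewrite -{1}pf pattern_eq -pg pattern_eq.
- by move=> j jS; apply/eqP; rewrite diffcol_eq0 fg.
- exact: imset_f.
Qed.

End Collapse.

(** * Moments of a binomial random subset *)

Section RandomSubset.
Variables (R : realFieldType) (T : finType) (p : R).
Hypothesis p01 : 0 <= p <= 1.
Implicit Types A S : {set T}.

Definition setprob A : R := p ^+ #|A| * (1 - p) ^+ (#|T| - #|A|).

Lemma setprob_ge0 A : 0 <= setprob A.
Proof. by case/andP: p01 => p0 p1; rewrite mulr_ge0 ?exprn_ge0 ?subr_ge0. Qed.

(** Expand a product over elements, each contributing [p] when included and [0] or [1 - p] when
    excluded, according to membership in [S]: the terms omitting an element of [S] vanish. *)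
Lemma sum_setprob_superset S : \sum_(A : {set T} | S \subset A) setprob A = p ^+ #|S|.
Proof.
have -> : p ^+ #|S| = \prod_i (p + (if i \in S then 0 else 1 - p)).
  rewrite (bigID (mem S)) /= [X in _ * X]big1 ?mulr1.
    by under eq_bigr => i -> do rewrite addr0; rewrite prodr_const.
  by move=> i /negbTE ->; rewrite addrC subrK.
rewrite bigA_distr big_mkcond /=; apply: eq_bigr => A _.
rewrite (bigID (mem A)) /=.
have -> : \prod_(i in A) (if i \in A then p else if i \in S then 0 else 1 - p) = p ^+ #|A|.
  by rewrite -prodr_const; apply: eq_bigr => i ->.
case: ifPn => [SA|/subsetPn[i iS iA]]; last first.
  by rewrite [X in _ = _ * X](bigD1 i) //= (negbTE iA) iS mul0r mulr0.
rewrite /setprob; congr (_ * _).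
have -> : (#|T| - #|A|)%N = #|~: A| by rewrite -(cardsC A) addKn.
rewrite -prodr_const; apply: eq_big => [i|i]; rewrite inE // => iA.
by rewrite (negbTE iA); case: ifP => // /(subsetP SA); rewrite (negbTE iA).
Qed.

Lemma sum_setprob : \sum_(A : {set T}) setprob A = 1.
Proof.
rewrite -[RHS](expr0 p) -(cards0 T) -sum_setprob_superset.
by apply: eq_bigl => A; rewrite sub0set.
Qed.

Lemma first_moment (I : finType) (D : pred I) (Z : I -> {set T}) (P : pred {set T}) :
  (forall A, P A -> exists2 i, D i & Z i \subset A) ->
  \sum_(A : {set T} | P A) setprob A <= \sum_(i | D i) p ^+ #|Z i|.
Proof.
move=> H; under [leRHS]eq_bigr do rewrite -sum_setprob_superset big_mkcond.
rewrite exchange_big /= big_mkcond; apply: ler_sum => A _.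
have ge0 i : 0 <= (if Z i \subset A then setprob A else 0).
  by case: ifP; rewrite ?setprob_ge0.
case: ifP => [/H[i Di ZA]|_]; last exact: sumr_ge0.
by rewrite (bigD1 i) //= ZA lerDl sumr_ge0.
Qed.

(** Chebyshev's inequality for the number [X] of indices [i] with [Z i] contained in [A]: on the
    event in question [X = 0], so the squared deviation is [mu ^+ 2]. *)
Lemma second_moment (I : finType) (D : {set I}) (Z : I -> {set T}) (k : nat) :
  (forall i, i \in D -> #|Z i| = k) ->
  (\sum_(A : {set T} | [forall i in D, ~~ (Z i \subset A)]) setprob A) * (#|D|%:R * p ^+ k) ^+ 2
  <= \sum_(i in D) \sum_(j in D | Z i :&: Z j != set0) p ^+ #|Z i :|: Z j|.
Proof.
move=> cZ; set mu := #|D|%:R * p ^+ k.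
have p0 : 0 <= p by case/andP: p01.
pose X A : R := \sum_(i in D) (Z i \subset A)%:R.
have EX : \sum_(A : {set T}) setprob A * X A = mu.
  under eq_bigr do rewrite mulr_sumr.
  rewrite exchange_big /mu mulr_natl -sumr_const /=. apply: eq_bigr => i iD.
  rewrite -(cZ i iD) -sum_setprob_superset [RHS]big_mkcond.
  by apply: eq_bigr => A _; case: ifP; rewrite ?mulr1 ?mulr0.
have EX2 : \sum_(A : {set T}) setprob A * X A ^+ 2 = \sum_(i in D) \sum_(j in D) p ^+ #|Z i :|: Z j|.
  transitivity (\sum_(A : {set T}) \sum_(i in D) \sum_(j in D) setprob A * (Z i :|: Z j \subset A)%:R).
    apply: eq_bigr => A _; rewrite expr2 /X big_distrlr mulr_sumr /=.
    apply: eq_bigr => i _; rewrite mulr_sumr; apply: eq_bigr => j _.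
    by rewrite -natrM mulnb subUset.
  rewrite exchange_big; apply: eq_bigr => i _; rewrite exchange_big; apply: eq_bigr => j _.
  rewrite -sum_setprob_superset [RHS]big_mkcond.
  by apply: eq_bigr => A _; case: ifP; rewrite ?mulr1 ?mulr0.
have var : \sum_(A : {set T}) setprob A * (X A - mu) ^+ 2 = \sum_(A : {set T}) setprob A * X A ^+ 2 - mu ^+ 2.
  have -> : \sum_(A : {set T}) setprob A * (X A - mu) ^+ 2 =
    \sum_(A : {set T}) (setprob A * X A ^+ 2 - 2 * mu * (setprob A * X A) + mu ^+ 2 * setprob A).
    by apply: eq_bigr => A _; ring.
  by rewrite !big_split /= sumrN -!mulr_sumr EX sum_setprob; ring.
apply: (@le_trans _ _ (\sum_(A : {set T}) setprob A * (X A - mu) ^+ 2)).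
  rewrite mulr_suml big_mkcond; apply: ler_sum => A _; case: ifP => [/forall_inP H|_].
    rewrite /X big1 ?sub0r ?sqrrN // => i /H /negbTE -> //.
  by rewrite mulr_ge0 ?setprob_ge0 ?sqr_ge0.
rewrite var EX2 lerBlDr.
(* Spread [mu ^+ 2] over all pairs: it cancels the pairs with disjoint sets exactly, leaving only
   the intersecting ones. *)
have -> : mu ^+ 2 = \sum_(i in D) \sum_(j in D) p ^+ (k + k).
  rewrite (eq_bigr (fun=> p ^+ (k + k) *+ #|D|)); last by move=> i _; rewrite sumr_const.
  by rewrite sumr_const -mulrnA -mulr_natl natrM /mu exprD; ring.
rewrite -big_split /=; apply: ler_sum => i iD.
rewrite (bigID (fun j => Z i :&: Z j != set0)) /= lerD2l.
rewrite [leLHS]big_mkcond [leRHS]big_mkcond; apply: ler_sum => j _.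
case: (boolP (j \in D)) => //= jD; rewrite negbK; case: eqP => [e|_]; last exact: exprn_ge0.
by rewrite cardsU e cards0 subn0 !cZ.
Qed.

End RandomSubset.

(** * Solutions with distinct entries *)

Lemma leq_expn2r (e a b : nat) : (a <= b -> a ^ e <= b ^ e)%N.
Proof. by case: e => // e ab; rewrite leq_exp2r. Qed.

(** Two perturbations differ by at most [2 * s], less than the dilation factor, so perturbing
    dilated entries cannot make distinct ones collide. *)
Lemma dilate_inj (s : nat) (a b : int) (u u' v v' : 'I_s.+1) :
  (2 * s).+1%:Z * a + (u%:Z - u'%:Z) = (2 * s).+1%:Z * b + (v%:Z - v'%:Z) -> a = b.
Proof.
move: (ltn_ord u) (ltn_ord u') (ltn_ord v) (ltn_ord v').
have [d|d|//] := ltgtP a b => us us' vs vs' e; exfalso.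
  have : (2 * s).+1%:Z * (a + 1) <= (2 * s).+1%:Z * b by rewrite ler_wpM2l //; lia.
  by lia.
have : (2 * s).+1%:Z * (b + 1) <= (2 * s).+1%:Z * a by rewrite ler_wpM2l //; lia.
by lia.
Qed.

Section InjectiveSolutions.
Variables (r m : nat) (M : 'M[int]_(r, m)).

Lemma is_solution_comb (a : int) (x y : 'I_m -> int) :
  is_solution M x -> is_solution M y -> is_solution M (fun j => a * x j + y j).
Proof.
move=> /forallP sx /forallP sy; apply/forallP=> i.
under eq_bigr do rewrite mulrDr mulrCA.
by rewrite big_split /= -mulr_sumr (eqP (sx i)) (eqP (sy i)) mulr0 addr0.
Qed.

Lemma distinct_positive_solution : admissible M ->
  exists x : 'I_m -> int, [/\ forall j, 0 < x j, is_solution M x & injective x].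
Proof.
move=> [[w [w0 sw]] irr _].
(* Irredundancy separates one pair at a time; the induction runs over a list of pairs already
   separated. *)
suff ex (s : seq ('I_m * 'I_m)) : exists x : 'I_m -> int,
    [/\ forall j, 0 < x j, is_solution M x &
        forall i j, (i, j) \in s -> i <> j -> x i <> x j].
  have [x [x0 sx dx]] := ex (enum {: 'I_m * 'I_m}).
  exists x; split=> // i j xij; apply/eqP/negPn/negP => /eqP ij.
  by apply: dx ij xij; rewrite mem_enum.
elim: s => [|[i j] s [x [x0 sx dx]]]; first by exists w.
have [eij|nij] := eqVneq i j.
  exists x; split=> // a b; rewrite in_cons => /orP[/eqP[-> ->] //|]; exact: dx.
have [exij|nxij] := eqVneq (x i) (x j); last first.
  by exists x; split=> // a b; rewrite in_cons => /orP[/eqP[-> ->] _|]; [apply/eqP|apply: dx].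
have [z [sz nz]] := irr i j (elimN eqP nij).
(* With [K] above twice every [|z k|], adding [z] to the dilated solution neither merges separated
   entries nor destroys positivity. *)
pose K : int := 1 + 2 * \sum_k `|z k|.
have zK k : 2 * `|z k| < K.
  rewrite /K (bigD1 k) //=; set u := \sum_(i | _) _.
  by have : 0 <= u by [apply: sumr_ge0]; lia.
exists (fun k => K * x k + z k); split; last first.
- move=> a b; rewrite in_cons => /orP[/eqP[-> ->] _|abs ab]; first by rewrite exij; lia.
  have := dx a b abs ab; have := zK a; have := zK b; nia.
- exact: is_solution_comb.
- by move=> k; have := x0 k; have := zK k; nia.
Qed.

Definition injective_solutions (n : nat) : {set {ffun 'I_m -> 'I_n}} :=
  [set f | is_solution M (ival f) & injectiveb f].

Definition lin_value (z : 'I_m -> int) (i : 'I_r) : int := \sum_j M i j * z j.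

(* Pigeonhole: [M] maps the [(s+1)^m] points of a box into a box of at most
   [(2bs+1)^r] points. *)
Lemma large_fibre : exists2 b : nat, (0 < b)%N & forall s : nat,
  exists2 Z : {set {ffun 'I_m -> 'I_s.+1}},
    (s.+1 ^ m <= (2 * b * s.+1) ^ r * #|Z|)%N &
    {in Z &, forall z z' : {ffun 'I_m -> 'I_s.+1}, forall i,
       lin_value (fun j => Posz (z j)) i = lin_value (fun j => Posz (z' j)) i}.
Proof.
pose b := (\sum_i \sum_j `|M i j|%N).+1; exists b => // s.
have vb (z : {ffun 'I_m -> 'I_s.+1}) i : (`|lin_value (fun j => Posz (z j)) i| <= b * s)%N.
  have : (`|lin_value (fun j => Posz (z j)) i| <= \sum_j `|M i j| * s)%N.
    rewrite /lin_value; elim/big_ind2: _ => // [x1 x2 y1 y2|j _]; first lia.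
    by rewrite abszM leq_mul2l absz_nat; have := ltn_ord (z j); lia.
  by rewrite -big_distrl /= /b (bigD1 i) //=; nia.
(* The shift by [b * s] makes all values non-negative and at most [2 * (b * s)], so that [inord] is
   faithful. *)
pose phi (z : {ffun 'I_m -> 'I_s.+1}) : {ffun 'I_r -> 'I_(2 * (b * s)).+1} :=
  [ffun i => inord `|(lin_value (fun j => Posz (z j)) i + (b * s)%N)%R|%N].
pose c (w : {ffun 'I_r -> 'I_(2 * (b * s)).+1}) := #|[set z | phi z == w]|.
have [|w mw] := bigop.eq_bigmax c.
  by rewrite card_ffun !card_ord expn_gt0.
exists [set z | phi z == w].
  have : (\sum_w' c w' <= \sum_(w' : {ffun 'I_r -> 'I_(2 * (b * s)).+1}) c w)%N.
    by apply: leq_sum => w' _; rewrite -mw; apply: bigop.leq_bigmax.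
  rewrite sum_nat_const card_ffun !card_ord.
  have <- : (s.+1 ^ m)%N = (\sum_w' c w')%N.
    transitivity #|{ffun 'I_m -> 'I_s.+1}|; first by rewrite card_ffun !card_ord.
    rewrite -sum1_card (partition_big phi predT) //=; apply: eq_bigr => w' _.
    by rewrite /c -sum1_card; apply: eq_bigl => z; rewrite inE.
  move=> /leq_trans; apply; rewrite leq_mul2r; apply/orP; right.
  by apply: leq_expn2r; nia.
move=> z z'; rewrite !inE => /eqP <- /eqP /ffunP e i.
have := congr1 val (e i); rewrite !ffunE /=.
by have := vb z i; have := vb z' i; move=> ? ?; rewrite !inordK; lia.
Qed.

Lemma many_injective_solutions : (r < m)%N -> admissible M ->
  exists K C : nat, [/\ (0 < K)%N, (0 < C)%N &
    forall n, (K <= n)%N -> (n ^ (m - r) <= C * #|injective_solutions n|)%N].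
Proof.
move=> rm /distinct_positive_solution[x [x0 sx xinj]].
have [b b0 fib] := large_fibre.
pose X := (\sum_j `|x j|)%N.
have xX j : x j <= X by rewrite /X (bigD1 j) //=; lia.
have X0 : (0 < X)%N.
  by have := x0 (Ordinal (leq_ltn_trans (leq0n r) rm)); have := xX (Ordinal (leq_ltn_trans (leq0n r) rm)); lia.
(* For [s] and [X] at least 1, [(2 s + 1) X + s <= 4 s X <= n], so the perturbed entries fit in
   $[n]$. The second constant combines [n < (s + 1) K] with [(s + 1)^(m - r) <= (2 b)^r #|Z|]. *)
pose K := (4 * X)%N; exists K, (K ^ (m - r) * (2 * b) ^ r)%N.
split; [by lia|by rewrite muln_gt0 !expn_gt0; lia|].
case=> [|n'] Kn; first by lia.
set n := n'.+1; pose s := (n %/ K)%N.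
have s0 : (0 < s)%N by rewrite divn_gt0; lia.
have sK : (s * K <= n)%N by exact: leq_trunc_div.
have nK : (n < s.+1 * K)%N by rewrite ltn_ceil //; lia.
have [Z cZ HZ] := fib s.
have cZ' : (s.+1 ^ (m - r) <= (2 * b) ^ r * #|Z|)%N.
  rewrite -(leq_pmul2l (m := s.+1 ^ r)) ?expn_gt0 //.
  by rewrite -expnD subnKC ?(ltnW rm) // mulnA -expnMn (mulnC s.+1).
have [Z0|[z0 z0Z]] := set_0Vmem Z.
  by move: cZ; rewrite Z0 cards0 muln0 leqn0 expn_eq0.
have : (#|Z| <= #|injective_solutions n|)%N.
  (* [z] and [z0] lie in one fibre of [M], so their difference is an integer solution with entries
     between [-s] and [s]. *)
  pose y (z : {ffun 'I_m -> 'I_s.+1}) j : int := (2 * s).+1%:Z * x j + (Posz (z j) - Posz (z0 j)).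
  have y1 z j : 0 < y z j <= n.
    rewrite /y; have := ltn_ord (z j); have := ltn_ord (z0 j); have := x0 j; have := xX j.
    by move: sK s0 X0; rewrite /K; nia.
  (* The shift by one matches [ival], where [a : 'I_n] stands for [a + 1]. *)
  pose h z : {ffun 'I_m -> 'I_n} := [ffun j => inord `|(y z j - 1)%R|%N].
  have hy z : ival (h z) =1 y z.
    by move=> j; rewrite /ival /h ffunE; have := y1 z j; move=> ?; rewrite inordK; lia.
  have hinj : injective h.
    move=> z z' e; apply/ffunP=> j; apply/val_inj => /=.
    by have := hy z j; rewrite e hy /y; lia.
  rewrite -(card_imset _ hinj); apply/subset_leq_card/subsetP=> _ /imsetP[z zZ ->].
  rewrite inE; apply/andP; split.
    have -> : is_solution M (ival (h z)) = is_solution M (y z).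
      by apply: eq_forallb => i; under eq_bigr do rewrite hy.
    apply: is_solution_comb => //; apply/forallP=> i.
    under eq_bigr do rewrite mulrBr; rewrite sumrB subr_eq0; apply/eqP; exact: HZ.
  apply/injectiveP=> i j /eqP; rewrite -ival_eq !hy /y => /eqP e; apply: xinj.
  by apply: dilate_inj e.
move=> cI; apply: (@leq_trans ((s.+1 * K) ^ (m - r))); first by rewrite leq_exp2r ?(ltnW nK) // subn_gt0.
rewrite expnMn; rewrite mulnC -mulnA leq_mul2l; apply/orP; right.
by apply: leq_trans cZ' _; rewrite leq_mul2l cI orbT.
Qed.

End InjectiveSolutions.

(** * Moment bounds in terms of ranks of column submatrices *)

Section Bounds.
Variables (R : realFieldType) (p : R).
Hypothesis p01 : 0 <= p <= 1.
Variables (r m : nat) (M : 'M[int]_(r, m)).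

(** The union bound runs over the sets [f @: Q], sorted by pattern, and not over whole solutions.
    The condition on [pi] holds for every pattern that occurs and keeps the truncated exponent
    exact. *)
Lemma prob_nontriv_upper (n : nat) (Q : {set 'I_m}) :
  \sum_(A : {set 'I_n} | has_nontriv_sol M A) setprob p A <=
  \sum_(pi : {ffun 'I_m -> 'I_m} | (r <= #|pi @: Q| + crank M Q)%N)
    (n ^ (#|pi @: Q| - (r - crank M Q)))%:R * p ^+ #|pi @: Q|.
Proof.
have p0 : 0 <= p by case/andP: p01.
pose F (pi : {ffun 'I_m -> 'I_m}) : {set {ffun 'I_m -> 'I_n}} :=
  [set f | [&& is_solution M (ival f), nontrivial M (ival f) & pattern Q f == pi]].
pose im pi := [set f @: Q | f : {ffun 'I_m -> 'I_n} in F pi].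
apply: le_trans (first_moment (I := ({ffun 'I_m -> 'I_m} * {set 'I_n})%type)
  (D := fun t => t.2 \in im t.1) (Z := snd) p01 _) _.
  move=> A /existsP[f /andP[/andP[/forallP fA sf] nf]].
  exists (pattern Q f, f @: Q) => /=.
    by apply: imset_f; rewrite inE sf nf eqxx.
  by apply/subsetP=> _ /imsetP[i _ ->].
rewrite -(pair_big_dep predT (fun pi Z => Z \in im pi) (fun _ Z => p ^+ #|Z|)) /=.
rewrite [leRHS]big_mkcond; apply: ler_sum => pi _.
have [F0|Fn0] := eqVneq (F pi) set0.
  rewrite /im F0 imset0 big_set0; case: ifP => // _.
  by rewrite mulr_ge0 ?ler0n ?exprn_ge0.
have [] := @card_images r m M Q n (F pi) pi Fn0.
  by move=> f; rewrite inE => /and3P[? ? /eqP].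
move=> -> cim; rewrite (eq_bigr (fun=> p ^+ #|pi @: Q|)); last first.
  move=> _ /imsetP[f + ->]; rewrite inE => /and3P[_ _ /eqP <-].
  by rewrite card_pattern.
by rewrite sumr_const -[leLHS]mulr_natl ler_wpM2r ?exprn_ge0 // ler_nat.
Qed.

(** For fixed [f], sort the solutions [g] by the set [Q] of positions whose entries occur in [f],
    and by where in [f] they occur, at most [m ^ m] ways. This fixes [g] on [Q], and the two entry
    sets together have [m + m - #|Q|] elements. *)
Lemma prob_trivial_upper (n : nat) : zrank M = r ->
  (\sum_(A : {set 'I_n} | ~~ has_nontriv_sol M A) setprob p A) *
    (#|injective_solutions M n|%:R * p ^+ m) ^+ 2 <=
  #|injective_solutions M n|%:R *
    \sum_(Q : {set 'I_m} | Q != set0)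
      (m ^ m)%:R * ((n ^ (m - #|Q| - crank M Q))%:R * p ^+ (m + m - #|Q|)).
Proof.
move=> rM; set F := injective_solutions M n.
have p0 : 0 <= p by case/andP: p01.
have Finj f : f \in F -> injective f by rewrite inE => /andP[_ /injectiveP].
have Fsol f : f \in F -> is_solution M (ival f) by rewrite inE => /andP[].
pose Z (f : {ffun 'I_m -> 'I_n}) := f @: [set: 'I_m].
have cZ f : f \in F -> #|Z f| = m.
  by move=> fF; rewrite card_imset ?cardsT ?card_ord //; apply: Finj.
have := second_moment p01 cZ; set X := (X in _ <= X); move=> le2.
apply: (@le_trans _ _ X); last first.
  rewrite {le2}/X mulr_natl -sumr_const; apply: ler_sum => f fF.
  pose hit (g : {ffun 'I_m -> 'I_n}) : {set 'I_m} := [set j | g j \in Z f].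
  (* Outside [hit g] the value is the irrelevant default [j]. *)
  pose loc (g : {ffun 'I_m -> 'I_n}) : {ffun 'I_m -> 'I_m} :=
    [ffun j => odflt j [pick i | f i == g j]].
  have locP g j : j \in hit g -> f (loc g j) = g j.
    rewrite inE => /imsetP[i _ e]; rewrite ffunE; case: pickP => [k /eqP //|/(_ i)].
    by rewrite e eqxx.
  have ZI g : Z f :&: Z g = g @: hit g.
    apply/setP=> a; rewrite inE; apply/andP/imsetP => [[af /imsetP[j _ e]]|[j jh ->]].
      by exists j; rewrite // inE -e.
    by split; [rewrite inE in jh|apply: imset_f].
  have cI g : g \in F -> #|Z f :&: Z g| = #|hit g|.
    by move=> gF; rewrite ZI card_imset //; apply: Finj.
  rewrite (partition_big hit (fun Q => Q != set0)) /=; last first.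
    by move=> g /andP[gF]; rewrite ZI; apply: contraNneq => ->; rewrite imset0.
  apply: ler_sum => Q Q0.
  rewrite (partition_big loc predT) //=.
  have -> : (m ^ m)%N = #|{ffun 'I_m -> 'I_m}| by rewrite card_ffun !card_ord.
  rewrite mulr_natl -[#|{ffun 'I_m -> 'I_m}|]/#|predT| -sumr_const; apply: ler_sum => sg _.
  rewrite (eq_bigr (fun=> p ^+ (m + m - #|Q|))); last first.
    move=> g /andP[/andP[/andP[gF _] /eqP <-] _].
    by rewrite cardsU cI // !cZ.
  rewrite sumr_const -[leLHS]mulr_natl ler_wpM2r ?exprn_ge0 // ler_nat.
  set G := (X in #|X|); have -> : #|G| = #|[set g in G]| by rewrite cardsE.
  have HG g : g \in [set g in G] -> [/\ g \in F, hit g = Q & loc g = sg].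
    by rewrite inE => /andP[/andP[/andP[gF _] /eqP <-] /eqP <-].
  have [|g h gG hG i iQ|_] := @card_solutions_fixed r m M n [set g in G] Q.
  - by move=> g /HG[/Fsol].
  - have [_ hg lg] := HG g gG; have [_ hh lh] := HG h hG.
    by rewrite -(locP g) ?hg // -(locP h) ?hh // lg lh.
  by [].
apply: le_trans le2; rewrite ler_wpM2r ?sqr_ge0 //.
rewrite [leLHS]big_mkcond [leRHS]big_mkcond; apply: ler_sum => A _.
case: ifP => [nA|_]; last by case: ifP => // _; apply: setprob_ge0.
rewrite ifT //; apply/forall_inP => f fF; apply: contra nA => /subsetP fA.
apply/existsP; exists f; rewrite Fsol // nontrivial_injective // ?andbT.
  by apply/forallP=> j; apply: fA; apply: imset_f.
by move=> i j /eqP; rewrite ival_eq => /eqP /(Finj f fF).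
Qed.

End Bounds.

(** * The threshold *)

Section Threshold.
Variables (r m : nat) (M : 'M[int]_(r, m)).
Hypotheses (r_lt_m : (r < m)%N) (admM : admissible M).
Implicit Types Q : {set 'I_m}.

Let rankM : zrank M = r. Proof. by case: admM. Qed.

Lemma admissible_deficit Q : Q != set0 -> (r < #|Q| + crank M Q)%N.
Proof.
by case: admM => [[x [x0 sx]] _ _] Q0; rewrite addnC (rank_deficit_lt rankM sx).
Qed.

Lemma rQE Q : rQ M Q = (r - crank M Q)%:R.
Proof. by rewrite /rQ zrank_colsubset !INRE natrB ?crank_le. Qed.

Lemma card_sub_rQ_gt0 Q : Q != set0 -> 0 < #|Q|%:R - rQ M Q.
Proof.
move=> Q0; rewrite rQE subr_gt0 ltr_nat.
by have := admissible_deficit Q0; have := crank_le M Q; lia.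
Qed.

Lemma cM_ge Q : Q != set0 -> #|Q|%:R / (#|Q|%:R - rQ M Q) <= cM M.
Proof.
move=> Q0; rewrite /cM; have := mem_index_enum Q; elim: (index_enum _) => // Q' s IH.
rewrite in_cons big_cons => /orP[/eqP <-|/IH le].
  by rewrite Q0 RmaxE le_max -!INRE lexx.
by case: ifP => // _; rewrite RmaxE le_max le orbT.
Qed.

Lemma cM_gt0 : 0 < cM M.
Proof.
have T0 : [set: 'I_m] != set0.
  by apply/set0Pn; exists (Ordinal (leq_ltn_trans (leq0n r) r_lt_m)); rewrite inE.
apply: lt_le_trans (cM_ge T0); rewrite divr_gt0 ?card_sub_rQ_gt0 //.
by rewrite ltr0n card_gt0.
Qed.

Lemma cM_attained : exists2 Q : {set 'I_m}, Q != set0 & cM M = #|Q|%:R / (#|Q|%:R - rQ M Q).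
Proof.
(* The maximum is folded from 0, a value that comes from no [Q]; the guard [0 < x] excludes it. *)
pose attained (x : R) := 0 < x ->
  exists2 Q, Q != set0 & x = #|Q|%:R / (#|Q|%:R - rQ M Q).
suff: attained (cM M) by apply; apply: cM_gt0.
rewrite /cM; elim/big_rec: _ => [|Q x Q0 IH]; rewrite /attained; first by rewrite ltxx.
rewrite RmaxE /Num.max; case: ifP => _; first exact: IH.
by exists Q => //; rewrite -!INRE.
Qed.

(** Since $|Q|/c(M) = |Q| - r_Q$, the difference $k/c(M) - (k - r_Q)$ equals $r_Q(1 - k/|Q|)$. *)
Lemma pattern_exponent_le Q k : cM M = #|Q|%:R / (#|Q|%:R - rQ M Q) -> Q != set0 ->
  (k <= #|Q|)%N -> (r <= k + crank M Q)%N ->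
  (k - (r - crank M Q))%:R <= k%:R / cM M.
Proof.
move=> -> Q0 kQ rk; have d0 := card_sub_rQ_gt0 Q0; move: d0; rewrite rQE => d0.
have cr := crank_le M Q.
rewrite natrB; last by lia.
have q0 : (0 : R) < #|Q|%:R by rewrite ltr0n card_gt0.
rewrite invf_div mulrA ler_pdivlMr //.
have kQ' : (k%:R : R) <= #|Q|%:R by rewrite ler_nat.
have rho0 : (0 : R) <= (r - crank M Q)%:R by [].
have h : 0 <= (r - crank M Q)%:R * (#|Q|%:R - k%:R) :> R by rewrite mulr_ge0 ?subr_ge0.
by rewrite -subr_ge0; apply: le_trans h _; rewrite le_eqVlt; apply/orP; left; apply/eqP; ring.
Qed.

Lemma overlap_exponent_ge Q : Q != set0 ->
  #|Q|%:R / cM M <= (#|Q| + crank M Q - r)%:R.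
Proof.
move=> Q0; have := cM_ge Q0; have := card_sub_rQ_gt0 Q0.
have -> : #|Q|%:R - rQ M Q = (#|Q| + crank M Q - r)%:R.
  have := admissible_deficit Q0; have := crank_le M Q => ? ?.
  rewrite rQE -natrB; last by lia.
  by congr (_%:R); lia.
by move=> d0; rewrite ler_pdivrMr // ler_pdivrMr ?cM_gt0 // mulrC.
Qed.

(* [p n^(1/c(M))] *)
Definition scaled (p : nat -> R) (n : nat) : R := Rdiv (p n) (threshold_t M n).

Lemma scaled_expE p n k : (0 < n)%N ->
  scaled p n ^+ k = p n ^+ k * Rpower n%:R (k%:R / cM M).
Proof.
move=> n0; have n0' : Rlt 0 (INR n) by apply/RltP; rewrite INRE ltr0n.
rewrite /scaled /threshold_t Rpower_Ropp.
have -> : Rdiv (p n) (Rinv (Rpower (INR n) (Rinv (cM M)))) = p n * Rpower (INR n) (/ cM M).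
  by rewrite /Rdiv Rinv_inv.
rewrite exprMn; congr (_ * _).
rewrite -RpowE -Rpower_pow; last exact: exp_pos.
by rewrite Rpower_mult Rmult_comm !INRE RinvE.
Qed.

Lemma natr_Rpower n e : (0 < n)%N -> (n ^ e)%:R = Rpower n%:R e%:R.
Proof.
move=> n0; rewrite -!INRE Rpower_pow; last by apply/RltP; rewrite INRE ltr0n.
by rewrite RpowE !INRE natrX.
Qed.

Lemma Rpower_le n (a b : R) : (0 < n)%N -> a <= b -> Rpower n%:R a <= Rpower n%:R b.
Proof.
move=> n0 /RleP ab; apply/RleP; rewrite -INRE; apply: Rle_Rpower ab.
by apply/RleP; rewrite INRE ler1n.
Qed.

Lemma prob_nontrivE p n : prob_nontriv M p n =
  \sum_(A : {set 'I_n} | has_nontriv_sol M A) setprob (p n) A.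
Proof.
rewrite /prob_nontriv [RHS]big_mkcond; apply: eq_bigr => A _.
by case: ifP => // _; rewrite /setprob card_ord -!RpowE.
Qed.

Lemma prob_nontriv_le p n : 0 <= p n <= 1 -> (0 < n)%N -> 0 <= scaled p n <= 1 ->
  prob_nontriv M p n <= (m ^ m)%:R * scaled p n.
Proof.
move=> p01 n0 /andP[q0 q1].
have [Q Q0 cQ] := cM_attained.
rewrite prob_nontrivE; apply: le_trans (prob_nontriv_upper p01 M n Q) _.
have -> : (m ^ m)%N = #|{ffun 'I_m -> 'I_m}| by rewrite card_ffun !card_ord.
rewrite mulr_natl -sumr_const [leLHS]big_mkcond; apply: ler_sum => pi _.
case: ifP => // rk.
(* Each pattern contributes at most $q^k$ with $k \ge 1$ values on [Q], and $q^k \le q$ because $q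
   \le 1$. *)
apply: (@le_trans _ _ (scaled p n ^+ #|pi @: Q|)); last first.
  have [i iQ] := set0Pn _ Q0.
  have : (0 < #|pi @: Q|)%N by apply/card_gt0P; exists (pi i); apply: imset_f.
  by case: #|_| => // k _; rewrite exprS ler_piMr // exprn_ile1.
rewrite scaled_expE // mulrC; apply: ler_wpM2l.
  by rewrite exprn_ge0 //; case/andP: p01.
rewrite natr_Rpower //; apply: Rpower_le => //.
exact: pattern_exponent_le cQ Q0 (leq_imset_card _ _) rk.
Qed.

Lemma prob_nontriv_ge : exists K C : nat, [/\ (0 < K)%N, (0 < C)%N &
  forall p n, 0 <= p n <= 1 -> (K <= n)%N -> 1 <= scaled p n ->
    (1 - prob_nontriv M p n) * scaled p n <= C%:R].
Proof.
have [K [C [K0 C0 many]]] := many_injective_solutions r_lt_m admM.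
have m0 : (0 < m)%N by exact: leq_ltn_trans r_lt_m.
(* The factors count the overlap sets [Q], the placements of the overlap, and the loss in the number
   of solutions. *)
exists K, (#|{set 'I_m}| * (m ^ m * C))%N; split=> //.
  by rewrite !muln_gt0 C0 expn_gt0 m0 andbT /= andbT; apply/card_gt0P; exists set0.
move=> p n p01 Kn q1; have n0 : (0 < n)%N by exact: leq_trans Kn.
have p0 : 0 <= p n by case/andP: p01.
have ppos : 0 < p n.
  rewrite lt_neqAle p0 andbT; apply/eqP=> pn0; move: q1.
  by rewrite -[scaled p n]expr1 scaled_expE // -pn0 expr1 mul0r ler10.
set q := scaled p n in q1 *; have q0 : 0 <= q by exact: le_trans q1.
set F := #|injective_solutions M n|; set B := 1 - _.
have F0 : (0 : R) < F%:R.
  have := many n Kn; rewrite ltr0n -/F; case: F => //.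
  by rewrite muln0 leqn0 expn_eq0 (gtn_eqF n0).
have BE : B = \sum_(A : {set 'I_n} | ~~ has_nontriv_sol M A) setprob (p n) A.
  rewrite /B prob_nontrivE -(sum_setprob 'I_n (p n)).
  by rewrite (bigID (has_nontriv_sol M)) /= addrAC subrr add0r.
have W0 : 0 < (F%:R * p n ^+ m) ^+ 2 by rewrite exprn_gt0 // mulr_gt0 ?exprn_gt0.
rewrite -(ler_pM2r W0) mulrAC BE.
apply: le_trans (ler_wpM2r q0 (prob_trivial_upper p01 n rankM)) _.
rewrite -/F -mulrA mulr_suml.
apply: (@le_trans _ _ (F%:R * \sum_(Q : {set 'I_m}) (m ^ m * C)%:R * (F%:R * p n ^+ (m + m)))).
  rewrite ler_wpM2l ?ler0n // [leLHS]big_mkcond; apply: ler_sum => Q _.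
  case: ifPn => [Q0|_]; last by rewrite !mulr_ge0 ?ler0n ?exprn_ge0.
  have def := admissible_deficit Q0; have cr := crank_le M Q.
  (* The empty family serves here to extract only the inequality [crank M Q + #|Q| <= m]. *)
  have [cQ _] := @card_solutions_fixed r m M n set0 Q
    ltac:(by move=> f; rewrite inE) ltac:(by move=> f g; rewrite inE).
  (* As $q \ge 1$, one has $q \le q^{|Q|} \le n^{|Q|-r_Q} p^{|Q|}$; this absorbs the factor [q] into
     each overlap term. *)
  have le_q : q <= (n ^ (#|Q| + crank M Q - r))%:R * p n ^+ #|Q|.
    apply: (@le_trans _ _ (q ^+ #|Q|)).
      have : (0 < #|Q|)%N by rewrite card_gt0.
      by case: #|Q| => // k _; rewrite exprS ler_peMr // exprn_ege1.
    rewrite /q scaled_expE // mulrC; apply: ler_wpM2r; first exact: exprn_ge0.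
    by rewrite natr_Rpower //; apply: Rpower_le => //; apply: overlap_exponent_ge.
  rewrite natrM -!mulrA ler_wpM2l ?ler0n //.
  set a := (m - #|Q| - crank M Q)%N; set d := (#|Q| + crank M Q - r)%N in le_q.
  apply: (@le_trans _ _ ((n ^ a)%:R * (p n ^+ (m + m - #|Q|) * ((n ^ d)%:R * p n ^+ #|Q|)))).
    by rewrite !ler_wpM2l ?ler0n ?exprn_ge0.
  have -> : (n ^ a)%:R * (p n ^+ (m + m - #|Q|) * ((n ^ d)%:R * p n ^+ #|Q|)) =
            (n ^ (m - r))%:R * p n ^+ (m + m).
    (* The powers of [n] recombine to [n ^ (m - r)], which is at most [C] times the number of
       solutions counted. *)
    have -> : (m - r = a + d)%N.
      by rewrite /a /d; move: cQ def cr r_lt_m; clear; lia.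
    have -> : p n ^+ (m + m) = p n ^+ (m + m - #|Q|) * p n ^+ #|Q|.
      by rewrite -exprD subnK // (leq_trans (leq_trans (leq_addl _ _) cQ)) ?leq_addr.
    by rewrite expnD natrM mulrACA mulrA.
  by rewrite mulrA -natrM ler_wpM2r ?exprn_ge0 // ler_nat many.
rewrite sumr_const -[_ *+ #|_|]mulr_natl !natrM exprD.
rewrite le_eqVlt; apply/orP; left; apply/eqP.
by move: (F%:R : R) (p n ^+ m) => u v; ring.
Qed.

End Threshold.

(** * Passage to the limit *)

Lemma prob_nontriv_ge0_le1 (r m : nat) (M : 'M[int]_(r, m)) (p : nat -> R) (n : nat) :
  0 <= p n <= 1 -> 0 <= prob_nontriv M p n <= 1.
Proof.
move=> p01; rewrite prob_nontrivE sumr_ge0 /=; last by move=> A _; apply: setprob_ge0.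
rewrite -[leRHS](sum_setprob 'I_n (p n)) [leLHS]big_mkcond; apply: ler_sum => A _.
by case: ifP => // _; apply: setprob_ge0.
Qed.

Lemma scaled_ge0 (r m : nat) (M : 'M[int]_(r, m)) (p : nat -> R) (n : nat) :
  0 <= p n <= 1 -> (0 < n)%N -> 0 <= scaled M p n.
Proof.
move=> /andP[p0 _] n0; rewrite -[leRHS]expr1 scaled_expE // expr1 mulr_ge0 //.
by apply/ltW/RltP/exp_pos.
Qed.

(* The import of the algebra library has bound the key [R] to [ring_scope]. *)
Delimit Scope R_scope with R.

Theorem theorem1p2 (r m : nat) (M : 'M[int]_(r, m)) :
  (0 < r)%N -> (r < m)%N -> admissible M ->
  (forall p : nat -> R, (forall n, 0 <= p n <= 1)%R ->
     Un_cv (fun n => p n / threshold_t M n)%R 0%R ->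
     Un_cv (prob_nontriv M p) 0%R) /\
  (forall p : nat -> R, (forall n, 0 <= p n <= 1)%R ->
     cv_infty (fun n => p n / threshold_t M n)%R ->
     Un_cv (prob_nontriv M p) 1%R).
Proof.
move=> _ rm admM.
have p01E (p : nat -> R) : (forall n, Rle 0 (p n) /\ Rle (p n) 1) -> forall n, 0 <= p n <= 1.
  by move=> H n; have [/RleP -> /RleP ->] := H n.
split=> p /p01E p01 lim_scaled eps /RltP eps0.
  have mm0 : (0 : R) < (m ^ m)%:R.
    by rewrite ltr0n expn_gt0 (leq_ltn_trans (leq0n r) rm).
  (* The bound 1 puts [scaled M p n] in the range of the upper estimate; the other bound makes that
     estimate less than [eps]. *)
  have delta0 : 0 < Num.min 1 (eps / (m ^ m)%:R) by rewrite lt_min ltr01 divr_gt0.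
  have [N HN] := lim_scaled _ (elimT RltP delta0).
  exists N.+1 => n /ssrnat.leP nN; have n0 : (0 < n)%N by exact: leq_ltn_trans nN.
  have := HN n (elimT ssrnat.leP (ltnW nN)); rewrite -/(scaled M p n) => /RltP.
  have q0 := scaled_ge0 M (p01 n) n0.
  rewrite RdistE subr0 ger0_norm // lt_min => /andP[q1 qeps].
  have [P0 _] := andP (prob_nontriv_ge0_le1 M (p01 n)).
  apply/RltP; rewrite RdistE subr0 ger0_norm //.
  apply: le_lt_trans (prob_nontriv_le rm admM (p01 n) n0 _) _; first by rewrite q0 ltW.
  by rewrite mulrC -ltr_pdivlMr.
have [K [C [K0 C0 bound]]] := prob_nontriv_ge rm admM.
(* Beyond 1 the lower estimate applies, and beyond [C / eps] it leaves a failure probability below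
   [eps]. *)
have [N HN] := lim_scaled (Num.max 1 (C%:R / eps)).
exists (maxn K N) => n /ssrnat.leP; rewrite geq_max => /andP[Kn Nn].
have := HN n (elimT ssrnat.leP Nn); rewrite -/(scaled M p n) => /RltP; rewrite gt_max => /andP[q1 qC].
have [_ P1] := andP (prob_nontriv_ge0_le1 M (p01 n)).
apply/RltP; rewrite RdistE distrC ger0_norm ?subr_ge0 //.
have q0 : 0 < scaled M p n by exact: lt_trans q1.
rewrite -(ltr_pM2r q0); apply: le_lt_trans (bound p n (p01 n) Kn (ltW q1)) _.
by rewrite mulrC -ltr_pdivrMr.
Qed.
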